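(* Let $(M,F)$ be an $n$-dimensional Finsler manifold with geodesic spray coefficients $G^i$, let $\rho_G=\rho_G(x,y)$ be a smooth positively 1-homogeneous function on $TM\setminus\{0\}$ defining a generalized projective spray $PG^i=G^i-\rho_G y^i$, and let $PB_j{}^i{}_{kl}=\frac{\partial^3 PG^i}{\partial y^j\partial y^k\partial y^l}$ be the Berwald curvature of $PG$. Then $F$ is generalized projectively $R$-quadratic ($GPR$-quadratic) with respect to $\rho_G$ if and only if $$PB_j{}^{i}{}_{kl|0}-\rho_{G\,.r}\,PB_j{}^{r}{}_{kl}\,y^{i}=0 ,$$ where $|$ is the horizontal covariant derivative with respect to the Berwald connection of $F$ (i.e. of the spray $G$).
   Context: All formulas are in standard local coordinates $(x^i,y^i)$ on $TM\setminus\{0\}$, with the summation convention. The geodesic spray of $F$ is $G=y^i\frac{\partial}{\partial x^i}-2G^i\frac{\partial}{\partial y^i}$, with $G^i$ positively 2-homogeneous in $y$. Derivatives: the subscript $._r$ means $\partial/\partial y^r$. With $G^i_j=\partial G^i/\partial y^j$ and $G^i_{jk}=\partial^2G^i/\partial y^j\partial y^k$, the horizontal Berwald derivative is, e.g., $T^i_{j|m}=\frac{\partial T^i_j}{\partial x^m}-G^r_m\frac{\partial T^i_j}{\partial y^r}+G^i_{rm}T^r_j-G^r_{jm}T^i_r$, and similarly for other tensor types (one term $-G^r_{jm}T_{\cdots r\cdots}$ for each lower index $j$, one term $+G^i_{rm}T^{\cdots r\cdots}$ for each upper index $i$). The subscript $|0$ means $|m$ contracted with $y^m$. Generalized projective spray: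 $\rho_G$ is a smooth positively 1-homogeneous function associated with the spray $G$; $PG^i=G^i-\rho_G y^i$ is called a generalized projective spray with respect to $\rho_G$ if for every projective change $\tilde G^i=G^i+Py^i$ (with projective factor $P=P(x,y)$, 1-homogeneous in $y$) the associated function satisfies $\rho_{\tilde G}=\rho_G+P$, equivalently $P\tilde G^i:=\tilde G^i-\rho_{\tilde G}y^i=PG^i$. Riemann curvature: for a spray with coefficients $G^i$, $R^i_k=2\frac{\partial G^i}{\partial x^k}-\frac{\partial^2G^i}{\partial x^m\partial y^k}y^m+2G^m\frac{\partial^2G^i}{\partial y^m\partial y^k}-\frac{\partial G^i}{\partial y^m}\frac{\partial G^m}{\partial y^k}$, $R^i_{kl}=\frac13(R^i_{k.l}-R^i_{l.k})$, $R_j{}^i{}_{kl}=R^i_{kl.j}$. The generalized projective Riemann curvature $PR^i_k$ is the Riemann curvature of the spray $PG$, and $PR_j{}^i{}_{kl}$ is obtained from it by the same formulas. $F$ is called $GPR$-quadratic with respect to $\rho_G$ if $PR_j{}^i{}_{kl.m}=0$. *)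

(* Defs.v *)
From HB Require Import structures.
From mathcomp Require Import all_boot all_order all_algebra.
From mathcomp Require Import all_classical all_reals all_analysis.

Set Implicit Arguments.
Unset Strict Implicit.
Unset Printing Implicit Defensive.

Import Order.TTheory GRing.Theory Num.Theory.
Import numFieldNormedType.Exports.

Local Open Scope classical_set_scope.
Local Open Scope ring_scope.

(** * C^k and C^oo maps on an open set

    Maps are total; only their values near points of the open set [D] matter. *)

Fixpoint Ck_on (R : realType) (V W : normedModType R) (k : nat)
    (D : set V) (f : V -> W) : Prop :=
  match k with
  | 0%N => forall z, D z -> {for z, continuous f}
  | k'.+1 => (forall z, D z -> differentiable f z) /\
             (forall v, Ck_on k' D (fun z => 'D_v f z))
  end.

Definition smooth_on (R : realType) (V W : normedModType R)
    (D : set V) (f : V -> W) : Prop := forall k, Ck_on k D f.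

(** * Smooth manifolds *)

Record smooth_atlas (R : realType) (n : nat) (M : topologicalType) :=
  SmoothAtlas {
    chart_index : Type;
    chart_dom : chart_index -> set M;
    chart : chart_index -> M -> 'rV[R]_n;
    chart_inv : chart_index -> 'rV[R]_n -> M;
    chart_cover : forall p, exists a, chart_dom a p;
    open_chart_dom : forall a, open (chart_dom a);
    open_chart_cod : forall a, open (chart a @` chart_dom a);
    chartK : forall a p, chart_dom a p -> chart_inv a (chart a p) = p;
    chart_continuous : forall a, {within chart_dom a, continuous (chart a)};
    chart_inv_continuous : forall a,
      {within chart a @` chart_dom a, continuous (chart_inv a)};
    transition_smooth : forall a b,
      smooth_on (chart a @` (chart_dom a `&` chart_dom b))
                (chart b \o chart_inv a)
  }.

Definition smooth_manifold (R : realType) (n : nat) (M : topologicalType)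
    (A : smooth_atlas R n M) : Prop :=
  hausdorff_space M /\ @second_countable M.

(** * Functions on the tangent bundle, in standard local coordinates

    [f x y] is the value at the point with coordinates [(x^i, y^i)]; the
    coordinates themselves are the entries [x 0 i] and [y 0 i]. *)

Definition field (R : realType) (n : nat) : Type :=
  'rV[R]_n -> 'rV[R]_n -> R.

Section TangentBundle.
Variables (R : realType) (n : nat) (M : topologicalType).
Variable A : smooth_atlas R n M.

Definition chart_cod (a : chart_index A) : set 'rV[R]_n :=
  chart a @` chart_dom a.

Definition chart_overlap (a b : chart_index A) : set 'rV[R]_n :=
  chart a @` (chart_dom a `&` chart_dom b).

Definition transition (a b : chart_index A) : 'rV[R]_n -> 'rV[R]_n :=
  chart b \o chart_inv a.

(* the part of TM minus its zero section over the chart a *)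
Definition slit (a : chart_index A) : set ('rV[R]_n * 'rV[R]_n) :=
  [set z | chart_cod a z.1 /\ z.2 != 0].

(* The local expressions f a agree under the change of coordinates
   x |-> tau x, y |-> (D tau)(x) y; the latter vector is 'D_y tau x. *)
Definition function_on_TM (f : chart_index A -> field R n) : Prop :=
  forall a b x y, chart_overlap a b x ->
    f a x y = f b (transition a b x) ('D_y (transition a b) x).

Definition function_on_slit_TM (f : chart_index A -> field R n) : Prop :=
  forall a b x y, chart_overlap a b x -> y != 0 ->
    f a x y = f b (transition a b x) ('D_y (transition a b) x).

Definition smooth_on_slit_TM (f : chart_index A -> field R n) : Prop :=
  forall a, smooth_on (slit a) (fun z => f a z.1 z.2).

Definition homogeneous1_on_slit_TM (f : chart_index A -> field R n) : Prop :=
  forall a x y t, slit a (x, y) -> 0 < t -> f a x (t *: y) = t * f a x y.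

(* smooth positively 1-homogeneous functions on TM \ {0} *)
Definition smooth_homogeneous1 (f : chart_index A -> field R n) : Prop :=
  [/\ function_on_slit_TM f, smooth_on_slit_TM f & homogeneous1_on_slit_TM f].

End TangentBundle.

(** * Local tensor calculus *)

Section LocalFormulas.
Variables (R : realType) (n : nat).
Implicit Types (f F rho : field R n) (G : 'I_n -> field R n).
Implicit Types (i j k l m r : 'I_n) (x y : 'rV[R]_n).

Definition dx i f : field R n := fun x y => 'D_(delta_mx 0 i) (f ^~ y) x.

Definition dy i f : field R n := fun x y => 'D_(delta_mx 0 i) (f x) y.

Definition sqf F : field R n := fun x y => F x y ^+ 2.

Definition fundamental_tensor F x y : 'M[R]_n :=
  \matrix_(i, j) (2^-1 * dy i (dy j (sqf F)) x y).

(* G^i = 1/4 g^{il} ([F^2]_{x^k y^l} y^k - [F^2]_{x^l}) *)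
Definition geodesic_coef F i : field R n := fun x y =>
  4^-1 * \sum_l invmx (fundamental_tensor F x y) i l *
    (\sum_k dy l (dx k (sqf F)) x y * y 0 k - dx l (sqf F) x y).

(* G^i_j, G^i_{jk} *)
Definition spray1 G i j : field R n := dy j (G i).
Definition spray2 G i j k : field R n := dy k (dy j (G i)).

(* B_j^i_{kl}; the upper index comes first *)
Definition berwald G i j k l : field R n := dy l (dy k (dy j (G i))).

(* R^i_k *)
Definition riemann G i k : field R n := fun x y =>
  2 * dx k (G i) x y
  - \sum_m dy k (dx m (G i)) x y * y 0 m
  + 2 * (\sum_m G m x y * dy k (dy m (G i)) x y)
  - \sum_m dy m (G i) x y * dy k (G m) x y.

(* R^i_{kl} *)
Definition riemann3 G i k l : field R n := fun x y =>
  3^-1 * (dy l (riemann G i k) x y - dy k (riemann G i l) x y).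

(* R_j^i_{kl}; the upper index comes first *)
Definition riemann4 G i j k l : field R n := dy j (riemann3 G i k l).

(* T_j^i_{kl|m}, for the Berwald connection of the spray G *)
Definition horizontal_derivative G
    (T : 'I_n -> 'I_n -> 'I_n -> 'I_n -> field R n) i j k l m : field R n :=
  fun x y =>
    dx m (T i j k l) x y
    - \sum_r spray1 G r m x y * dy r (T i j k l) x y
    + \sum_r spray2 G i r m x y * T r j k l x y
    - \sum_r spray2 G r j m x y * T i r k l x y
    - \sum_r spray2 G r k m x y * T i j r l x y
    - \sum_r spray2 G r l m x y * T i j k r x y.

(* T_j^i_{kl|0} *)
Definition horizontal_derivative0 G T i j k l : field R n := fun x y =>
  \sum_m horizontal_derivative G T i j k l m x y * y 0 m.

(* G^i + P y^i *)
Definition projective_change G (P : field R n) i : field R n := fun x y =>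
  G i x y + P x y * y 0 i.

(* PG^i = G^i - rho y^i *)
Definition projective_spray rho G i : field R n := fun x y =>
  G i x y - rho x y * y 0 i.

End LocalFormulas.

(** * Finsler structures and generalized projective sprays *)

Section Finsler.
Variables (R : realType) (n : nat) (M : topologicalType).
Variable A : smooth_atlas R n M.

Record finsler_metric (F : chart_index A -> field R n) : Prop :=
  FinslerMetric {
    finsler_function : function_on_TM F;
    finsler_ge0 : forall a x y, chart_cod a x -> 0 <= F a x y;
    finsler_smooth : smooth_on_slit_TM F;
    finsler_homogeneous : forall a x y t, chart_cod a x -> 0 < t ->
      F a x (t *: y) = t * F a x y;
    finsler_convex : forall a x y, slit a (x, y) ->
      forall v : 'rV[R]_n, v != 0 ->
        0 < (v *m fundamental_tensor (F a) x y *m v^T) 0 0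
  }.

(* coefficients of a spray, in every chart *)
Definition spray_coef : Type := chart_index A -> 'I_n -> field R n.

Definition geodesic_spray (F : chart_index A -> field R n) : spray_coef :=
  fun a => geodesic_coef (F a).

(* [rho] associates a function [rho G] to each spray [G]. Only its values on
   the sprays projectively related to the given [G] are constrained. *)
Definition generalized_projective
    (rho : spray_coef -> chart_index A -> field R n) (G : spray_coef) : Prop :=
  smooth_homogeneous1 (rho G) /\
  forall P : chart_index A -> field R n, smooth_homogeneous1 P ->
    forall a x y, slit a (x, y) ->
      rho (fun b => projective_change (G b) (P b)) a x y
      = rho G a x y + P a x y.

(* PR_j^i_{kl.m} = 0, for the function rhoG = rho_G *)
Definition GPR_quadratic (F rhoG : chart_index A -> field R n) : Prop :=
  forall a x y, slit a (x, y) -> forall i j k l m : 'I_n,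
    dy m (riemann4 (projective_spray (rhoG a) (geodesic_spray F a)) i j k l) x y
    = 0.

End Finsler.

(* Main.v *)
Require Import Defs.
From HB Require Import structures.
From mathcomp Require Import all_boot all_order all_algebra.
From mathcomp Require Import all_classical all_reals all_analysis.
From mathcomp Require Import perm ring lra.
Import Order.TTheory GRing.Theory Num.Theory.
Import numFieldNormedType.Exports.
Local Open Scope classical_set_scope.
Local Open Scope ring_scope.

Set Implicit Arguments.
Unset Strict Implicit.
Unset Printing Implicit Defensive.

(** Write [H = PG] and let [B] be its Berwald curvature. Commuting partial
    derivatives gives, for any spray [H], the Bianchi identity
    [R_j^i_{kl.p} = B_j^i_{lp|k} - B_j^i_{kp|l}], with [|] taken for [H].
    Hence [R]-quadraticity means that [B_j^i_{kl|m}] is symmetric under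
    exchange of [m] with a lower index. Contracting such a symmetry with [y]
    gives [B_j^i_{kl|0} = 0], since [B] is homogeneous of degree -1 and
    [B_j^i_{kl} y^l = 0]. Conversely,
    [(B_j^i_{kl|0})_{.q} = B_j^i_{kl|q} + S_j^i_{klq}] with [S] totally
    symmetric in [j, k, l, q], so [B_j^i_{kl|0} = 0] forces the symmetry.
    Finally, Euler's relations turn [|0] for [H = G - rho y] into
    [B_j^i_{kl|0} - rho_{.r} B_j^r_{kl} y^i] with [|0] taken for [G]. *)

(** * Smooth functions on an open set *)

Section Locality.
Variables (R : realType) (V W : normedModType R).
Implicit Types (f g : V -> W) (D : set V).

(** The zero map serves as the differential, with a remainder that vanishes identically near [z].
    This is what makes differentiability local: [g] is [f] plus [g - f], and the latter vanishes
    near [z] when the two agree there. *)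
Lemma differentiable_near0 f z :
  (\forall u \near z, f u = 0) -> differentiable f z.
Proof.
move=> f0; have fz0 : f z = 0 by exact: nbhs_singleton f0.
have df : f \o shift z = cst (f z) + 0 +o_0 id.
  apply/eqaddoP => _/posnumP[e]; rewrite fz0.
  have f0' : \forall h \near 0, f (h + z) = 0.
    move: f0; rewrite (near_shift 0) /=.
    by apply: filterS => u /=; rewrite subr0.
  near=> h; rewrite /= !fctE /= addr0 subr0.
  have -> : f (h + z) = 0 by near: h.
  by rewrite normr0 mulr_ge0.
have c0 : continuous (\0%R : V -> W) by exact: cst_continuous.
have d0 : 'd f z = 0 :> (V -> W) by exact: (@diff_unique _ _ _ f \0%R z).
by apply/diff_locallyP; rewrite d0; split=> //; exact: c0.
Unshelve. all: by end_near. Qed.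

Lemma differentiable_near_eq f g z :
  (\forall u \near z, f u = g u) -> differentiable f z -> differentiable g z.
Proof.
move=> fg df; rewrite (_ : g = f + (g - f)); last by rewrite addrC subrK.
apply: differentiableD => //; apply: differentiable_near0.
by apply: filterS fg => u fgu; rewrite !fctE fgu subrr.
Qed.

Lemma open_near_eq D f g z : open D -> {in D, f =1 g} -> D z ->
  \forall u \near z, f u = g u.
Proof.
move=> oD fg Dz; have := open_nbhs_nbhs (conj oD Dz).
by apply: filterS => u Du; apply: fg; rewrite inE.
Qed.

Lemma derive_eq_on D f g v : open D -> {in D, f =1 g} ->
  {in D, (fun z => 'D_v f z) =1 (fun z => 'D_v g z)}.
Proof.
move=> oD fg z; rewrite inE => Dz.
exact/near_eq_derive/(open_near_eq oD fg).
Qed.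

(** Since [D] is open, agreement on [D] passes to directional derivatives. The inductions on [k]
    below use this to replace a derivative by its closed formula, which holds only on [D]. *)
Lemma Ck_on_eq k D f g : open D -> {in D, f =1 g} -> Ck_on k D f -> Ck_on k D g.
Proof.
move=> oD; elim: k f g => [|k IHk] f g fg.
  move=> cf z Dz; have fgz := open_near_eq oD fg Dz.
  rewrite /prop_for /continuous_at -(nbhs_singleton fgz).
  by apply: cvg_trans (cf z Dz); apply: near_eq_cvg.
move=> [df Cf]; split=> [z Dz|v].
  by apply: differentiable_near_eq (df z Dz); exact: (open_near_eq oD fg).
exact: IHk (derive_eq_on v oD fg) (Cf v).
Qed.

Lemma Ck_onS k D f : Ck_on k.+1 D f -> Ck_on k D f.
Proof.
elim: k f => [|k IHk] f [df Cf].
  by move=> z /df/differentiable_continuous.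
by split=> // v; apply: IHk; exact: Cf.
Qed.

End Locality.

Section Smooth.
Variables (R : realType) (V : normedModType R) (D : set V).
Hypothesis oD : open D.
Implicit Types f g : V -> R.

Lemma Ck_on_cst k (c : R) : Ck_on k D (cst c).
Proof.
elim: k c => [|k IHk] c; first by move=> z _; exact: cst_continuous.
split=> [z _|v]; first exact: differentiable_cst.
by apply: Ck_on_eq (IHk 0) => // z _; rewrite derive_cst.
Qed.

Lemma Ck_onD k f g : Ck_on k D f -> Ck_on k D g ->
  Ck_on k D (fun z => f z + g z).
Proof.
elim: k f g => [|k IHk] f g.
  by move=> cf cg z Dz; apply: cvgD; [exact: cf|exact: cg].
move=> [df Cf] [dg Cg]; split=> [z Dz|v].
  exact: differentiableD (df z Dz) (dg z Dz).
apply: Ck_on_eq (IHk _ _ (Cf v) (Cg v)) => // z; rewrite inE => Dz.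
by rewrite deriveD//; apply: diff_derivable; auto.
Qed.

Lemma Ck_onM k f g : Ck_on k D f -> Ck_on k D g ->
  Ck_on k D (fun z => f z * g z).
Proof.
elim: k f g => [|k IHk] f g.
  by move=> cf cg z Dz; apply: cvgM; [exact: cf|exact: cg].
move=> fS gS; have [df Cf] := fS; have [dg Cg] := gS.
split=> [z Dz|v]; first exact: differentiableM (df z Dz) (dg z Dz).
apply: (@Ck_on_eq _ _ _ k D (fun z => f z * 'D_v g z + g z * 'D_v f z)) => //.
  move=> z; rewrite inE => Dz.
  by rewrite deriveM//; apply: diff_derivable; auto.
exact: Ck_onD (IHk _ _ (Ck_onS fS) (Cg v)) (IHk _ _ (Ck_onS gS) (Cf v)).
Qed.

(** The derivative of the inverse is again a product of inverses of [f] and a derivative of [f], so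
    the induction hypothesis together with [Ck_onM] covers it. *)
Lemma Ck_onV k f : (forall z, D z -> f z != 0) -> Ck_on k D f ->
  Ck_on k D (fun z => (f z)^-1).
Proof.
move=> f0; elim: k => [|k IHk].
  by move=> cf z Dz; apply: continuousV; auto.
move=> fS; have [df Cf] := fS; have fVk := IHk (Ck_onS fS).
split=> [z Dz|v]; first by apply: differentiableV; auto.
apply: (@Ck_on_eq _ _ _ k D
  (fun z => (-1) * (f z)^-1 * (f z)^-1 * 'D_v f z)) => //.
  move=> z; rewrite inE => Dz; rewrite deriveV; last 2 first.
  - exact: f0.
  - by apply: diff_derivable; auto.
  by rewrite -[RHS]/(_ * _) -exprVn expr2 !mulNr mul1r.
exact: Ck_onM (Ck_onM (Ck_onM (Ck_on_cst k (-1)) fVk) fVk) (Cf v).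
Qed.

Lemma smooth_on_eq f g : {in D, f =1 g} -> smooth_on D f -> smooth_on D g.
Proof. by move=> fg sf k; exact: Ck_on_eq (sf k). Qed.

Lemma smooth_on_cst (c : R) : smooth_on D (fun=> c).
Proof. by move=> k; exact: Ck_on_cst. Qed.

Lemma smooth_onD f g : smooth_on D f -> smooth_on D g ->
  smooth_on D (fun z => f z + g z).
Proof. by move=> sf sg k; exact: Ck_onD. Qed.

Lemma smooth_onM f g : smooth_on D f -> smooth_on D g ->
  smooth_on D (fun z => f z * g z).
Proof. by move=> sf sg k; exact: Ck_onM. Qed.

Lemma smooth_onN f : smooth_on D f -> smooth_on D (fun z => - f z).
Proof.
move=> sf; apply: smooth_on_eq (smooth_onM (smooth_on_cst (-1)) sf) => z _.
by rewrite mulN1r.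
Qed.

Lemma smooth_onB f g : smooth_on D f -> smooth_on D g ->
  smooth_on D (fun z => f z - g z).
Proof. by move=> sf sg; apply: smooth_onD => //; exact: smooth_onN. Qed.

Lemma smooth_onV f : (forall z, D z -> f z != 0) -> smooth_on D f ->
  smooth_on D (fun z => (f z)^-1).
Proof. by move=> f0 sf k; exact: Ck_onV. Qed.

Lemma smooth_on_sum (I : Type) (s : seq I) (P : pred I) (f : I -> V -> R) :
  (forall i, smooth_on D (f i)) ->
  smooth_on D (fun z => \sum_(i <- s | P i) f i z).
Proof.
move=> sf; rewrite (_ : (fun z => _) = \sum_(i <- s | P i) f i); last first.
  by apply/funext => z; rewrite fct_sumE.
elim/big_ind : _ => [|g h|i _].
- exact: smooth_on_cst.
- exact: smooth_onD.
- exact: sf.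
Qed.

Lemma smooth_on_prod (I : Type) (s : seq I) (P : pred I) (f : I -> V -> R) :
  (forall i, smooth_on D (f i)) ->
  smooth_on D (fun z => \prod_(i <- s | P i) f i z).
Proof.
move=> sf; elim: s => [|i s IHs].
  by under eq_fun do rewrite big_nil; exact: smooth_on_cst.
under eq_fun do rewrite big_cons; case: (P i) => //.
exact: smooth_onM.
Qed.

Lemma smooth_on_derive f v : smooth_on D f -> smooth_on D (fun z => 'D_v f z).
Proof. by move=> sf k; have [_] := sf k.+1; exact. Qed.

Lemma smooth_on_differentiable f z : smooth_on D f -> D z -> differentiable f z.
Proof. by move=> sf; have [+ _] := sf 1%N; exact. Qed.


End Smooth.

(** * Symmetry of second directional derivatives *)

Section Schwarz.
Variables (R : realType) (V : normedModType R).
Implicit Types (f : V -> R) (z u v : V).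

Lemma derive_line f z v (s : R) : differentiable f (z + s *: v) ->
  is_derive s 1 (fun t => f (z + t *: v)) ('D_v f (z + s *: v)).
Proof.
move=> df.
have E : (fun h : R => h^-1 *: (((fun t => f (z + t *: v)) \o shift s)
      (h *: 1) - f (z + s *: v))) = (fun h => h^-1 *:
    ((f \o shift (z + s *: v)) (h *: v) - f (z + s *: v))).
  apply/funext => h; congr (_ *: (f _ - _)).
  by rewrite /= -[h *: 1]/(h * 1) mulr1 scalerDl addrCA.
have dfv := @diff_derivable _ _ _ f _ v df.
by apply: DeriveDef; rewrite /derivable /derive E.
Qed.

Lemma MVT_line f z v (s : R) : 0 < s ->
  (forall a, 0 <= a <= s -> differentiable f (z + a *: v)) ->
  exists2 a, 0 <= a <= s & f (z + s *: v) - f z = 'D_v f (z + a *: v) * s.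
Proof.
move=> s0 df.
have dline a : a \in `[0, s]%R ->
    is_derive a 1 (fun t => f (z + t *: v)) ('D_v f (z + a *: v)).
  by rewrite in_itv/= => as0; exact/derive_line/df.
have cline : {within `[0, s], continuous (fun t => f (z + t *: v))}.
  by apply: derivable_within_continuous => b /dline db; exact: ex_derive.
have [a as0] := MVT s0 (fun a as0 => dline a (subset_itv_oo_cc as0)) cline.
rewrite scale0r addr0 subr0 => ->; exists a => //.
by move: as0; rewrite in_itv/= => /andP[/ltW -> /ltW ->].
Qed.

(* The left side is symmetric in [u] and [v]: comparing the two mean values as
   [s] tends to 0 gives the symmetry of second derivatives. *)
Lemma second_difference (D : set V) f z u v (s : R) : open D -> Ck_on 2 D f ->
  0 < s ->
  (forall a b, 0 <= a <= s -> 0 <= b <= s -> D (z + a *: u + b *: v)) ->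
  exists a b, [/\ 0 <= a <= s, 0 <= b <= s &
    f (z + s *: u + s *: v) - f (z + s *: u) - f (z + s *: v) + f z =
    'D_v (fun w => 'D_u f w) (z + a *: u + b *: v) * s * s].
Proof.
move=> oD [df /(_ u)[dDf _]] s0 Ds.
have s0' : 0 <= (0 : R) <= s by rewrite lexx ltW.
have ss : 0 <= s <= s by rewrite lexx ltW.
have dshift w a : D (z + a *: u + w) ->
    differentiable (fun t => f (t + w)) (z + a *: u).
  move=> Dw; apply: (@differentiable_comp _ _ _ _ (fun t => t + w) f).
    exact: (@differentiableD _ _ _ id (cst w)).
  exact: df.
have dshiftE w a :
    'D_u (fun t => f (t + w)) (z + a *: u) = 'D_u f (z + a *: u + w).
  rewrite /derive [X in lim (X @ _)](_ : _ = (fun h => h^-1 *: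
    ((f \o shift (z + a *: u + w)) (h *: u) - f (z + a *: u + w))))//.
  by apply/funext => h /=; rewrite !addrA.
(* The second difference of [f] is the first difference of [g] along [u]: one mean value for [g]
   along [u], then one for ['D_u f] along [v]. *)
pose g t := f (t + s *: v) - f t.
have Dsv a : 0 <= a <= s -> D (z + a *: u + s *: v) by move=> as0; exact: Ds.
have D0 a : 0 <= a <= s -> D (z + a *: u).
  by move=> as0; rewrite -[X in D X]addr0 -(scale0r v); exact: Ds.
have [a as0 ga] : exists2 a, 0 <= a <= s &
    g (z + s *: u) - g z = 'D_u g (z + a *: u) * s.
  apply: MVT_line => // a as0.
  by apply: differentiableB; [exact/dshift/Dsv|exact/df/D0].
have [b bs0 gb] : exists2 b, 0 <= b <= s &
    'D_u f (z + a *: u + s *: v) - 'D_u f (z + a *: u) =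
    'D_v (fun w => 'D_u f w) (z + a *: u + b *: v) * s.
  apply: (@MVT_line (fun w => 'D_u f w)) => // b bs0.
  exact/dDf/Ds.
exists a, b; split=> //; rewrite -gb.
transitivity (g (z + s *: u) - g z).
  by rewrite /g (addrAC z); ring.
rewrite ga; congr (_ * _); rewrite -dshiftE -deriveB//;
  apply: diff_derivable; [exact/dshift/Dsv|exact/df/D0].
Qed.

Lemma nbhs_parallelogram z u v (P : set V) : nbhs z P ->
  exists2 s : R, 0 < s &
    forall a b, 0 <= a <= s -> 0 <= b <= s -> P (z + a *: u + b *: v).
Proof.
move=> /nbhs_ballP[e /= e0 eP]; pose d := 1 + `|u| + `|v|.
have d0 : 0 < d by rewrite /d -addrA ltr_wpDr// addr_ge0.
(* With [s = e / d / 2], the displacement has norm at most [s * (|u| + |v|) < 2 * s * d = e]; the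
   summand 1 keeps [d] positive when [u] and [v] both vanish. *)
exists (e / d / 2); first by rewrite !divr_gt0.
move=> a b /andP[a0 ale] /andP[b0 ble]; apply: eP.
rewrite -ball_normE/= -addrA opprD addrA subrr add0r normrN.
rewrite (le_lt_trans (ler_normD _ _))// !normrZ !ger0_norm//.
have s0 : 0 < e / d / 2 by rewrite !divr_gt0.
have le1 : a * `|u| <= e / d / 2 * `|u| by apply: ler_wpM2r.
have le2 : b * `|v| <= e / d / 2 * `|v| by apply: ler_wpM2r.
have -> : e = e / d / 2 * d + e / d / 2 * d.
  by field; rewrite gt_eqF.
rewrite (le_lt_trans (lerD le1 le2))// -mulrDr -mulrDr ltr_pM2l// /d.
by have := normr_ge0 u; have := normr_ge0 v; lra.
Qed.

Lemma derive_comm (D : set V) f u v z : open D -> Ck_on 2 D f -> D z ->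
  'D_u (fun w => 'D_v f w) z = 'D_v (fun w => 'D_u f w) z.
Proof.
move=> oD f2 Dz; have [_ f1] := f2.
set p := fun w => 'D_u (fun w => 'D_v f w) w.
set q := fun w => 'D_v (fun w => 'D_u f w) w.
have cp : {for z, continuous p} by exact: (f1 v).2 u z Dz.
have cq : {for z, continuous q} by exact: (f1 u).2 v z Dz.
apply/eqP; rewrite -subr_eq0 -normr_le0; apply/ler_addgt0Pr => e e0.
have e20 : 0 < e / 2 by rewrite divr_gt0.
have np : \forall w \near z, `|p z - p w| < e / 2.
  by move/cvgrPdist_lt : cp => /(_ _ e20).
have nq : \forall w \near z, `|q z - q w| < e / 2.
  by move/cvgrPdist_lt : cq => /(_ _ e20).
have nD : \forall w \near z, D w by exact: open_nbhs_nbhs.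
have [s s0 N] := nbhs_parallelogram u v (filterI (filterI np nq) nD).
have Ds a b (as0 : 0 <= a <= s) (bs0 : 0 <= b <= s) : D (z + a *: u + b *: v).
  by have [] := N a b as0 bs0.
have Ds' a b (as0 : 0 <= a <= s) (bs0 : 0 <= b <= s) : D (z + a *: v + b *: u).
  by rewrite addrAC; exact: Ds.
have [a [b [as0 bs0 E1]]] := second_difference oD f2 s0 Ds.
have [a' [b' [as0' bs0' E2]]] := second_difference oD f2 s0 Ds'.
(* Both mean values come from the same second difference, so after cancelling [s * s] a value of [q]
   near [z] equals a value of [p] near [z]; continuity of [p] and [q] at [z] does the rest. *)
have qp : q (z + a *: u + b *: v) = p (z + a' *: v + b' *: u).
  apply: (mulIf (lt0r_neq0 s0)); apply: (mulIf (lt0r_neq0 s0)).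
  apply: etrans (esym E1) (etrans _ E2).
  by rewrite (addrAC z (s *: v)) [in RHS](addrAC (f _)).
have [[_ N1] _] := N _ _ as0 bs0.
have [[N2 _] _] := N _ _ bs0' as0'.
have -> : 'D_u (fun w => 'D_v f w) z - 'D_v (fun w => 'D_u f w) z =
  (p z - p (z + a' *: v + b' *: u)) - (q z - q (z + a *: u + b *: v)).
  by rewrite qp opprB addrA subrK.
apply: le_trans (ler_normB _ _) _.
rewrite addrAC in N2.
have -> : 0 + e = e / 2 + e / 2 by rewrite add0r -splitr.
by apply: lerD; apply: ltW; [exact: N2|exact: N1].
Qed.

End Schwarz.

(** * Partial derivatives of functions of (x, y) *)

Section Fields.
Variables (R : realType) (n : nat).
Local Notation V := 'rV[R]_n.
Variable D : set (V * V).
Hypothesis oD : open D.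
Implicit Types (f g : field R n) (w : V * V) (i j k l m : 'I_n).

Definition smooth_field f := smooth_on D (fun z => f z.1 z.2).

(** [dx] and [dy] are both derivatives on the product space, along [ex i] and [ey i]; calculus rules
    are proved once for [pd] and hold for both. *)
Definition pd w f : field R n := fun x y =>
  'D_w (fun z : V * V => f z.1 z.2) (x, y).

(* Sealed, so that failed unifications do not unfold partial derivatives. *)
Fact partial_key : unit. Proof. by []. Qed.
Definition dX := locked_with partial_key (@dx R n).
Definition dY := locked_with partial_key (@dy R n).

Lemma dX_def : @dx R n = dX. Proof. by rewrite /dX unlock. Qed.
Lemma dY_def : @dy R n = dY. Proof. by rewrite /dY unlock. Qed.

Definition ex i : V * V := (delta_mx 0 i, 0).
Definition ey i : V * V := (0, delta_mx 0 i).

Lemma dxE i f : dX i f = pd (ex i) f.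
Proof.
apply/funext => x; apply/funext => y; rewrite -dX_def /dx /pd /derive.
rewrite [in RHS](_ : (fun h : R => _) = (fun h : R => h^-1 *:
  (((f ^~ y) \o shift x) (h *: delta_mx 0 i) - f x y)))//.
by apply/funext => h /=; rewrite scaler0 add0r.
Qed.

Lemma dyE i f : dY i f = pd (ey i) f.
Proof.
apply/funext => x; apply/funext => y; rewrite -dY_def /dy /pd /derive.
rewrite [in RHS](_ : (fun h : R => _) = (fun h : R => h^-1 *:
  ((f x \o shift y) (h *: delta_mx 0 i) - f x y)))//.
by apply/funext => h /=; rewrite scaler0 add0r.
Qed.

Lemma smooth_pd w f : smooth_field f -> smooth_field (pd w f).
Proof.
move=> sf; have := smooth_on_derive w sf.
by apply: smooth_on_eq => // -[].
Qed.

Lemma smooth_dx i f : smooth_field f -> smooth_field (dX i f).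
Proof. by rewrite dxE; exact: smooth_pd. Qed.

Lemma smooth_dy i f : smooth_field f -> smooth_field (dY i f).
Proof. by rewrite dyE; exact: smooth_pd. Qed.

Definition eq_fieldOn f g := forall x y, D (x, y) -> f x y = g x y.

Lemma pd_congr w f g : eq_fieldOn f g -> eq_fieldOn (pd w f) (pd w g).
Proof.
move=> fg x y Dxy; apply: derive_eq_on; [exact: oD| |by rewrite inE].
by move=> [x' y']; rewrite inE => /fg.
Qed.

Lemma dx_congr i f g : eq_fieldOn f g -> eq_fieldOn (dX i f) (dX i g).
Proof. by rewrite !dxE; exact: pd_congr. Qed.

Lemma dy_congr i f g : eq_fieldOn f g -> eq_fieldOn (dY i f) (dY i g).
Proof. by rewrite !dyE; exact: pd_congr. Qed.

Lemma smooth_fieldW f g : eq_fieldOn f g -> smooth_field f -> smooth_field g.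
Proof. by move=> fg; apply: smooth_on_eq => // -[x y]; rewrite inE => /fg. Qed.

Lemma smooth_field_differentiable f x y : smooth_field f -> D (x, y) ->
  differentiable (fun z : V * V => f z.1 z.2) (x, y).
Proof. exact: smooth_on_differentiable. Qed.

Lemma smooth_field_derivable f w x y : smooth_field f -> D (x, y) ->
  derivable (fun z : V * V => f z.1 z.2) (x, y) w.
Proof. by move=> sf Dxy; exact/diff_derivable/smooth_field_differentiable. Qed.

(** Smoothness travels with the derivative formula, so the rules below compose without separate side
    conditions, and [g] can be synthesized from the shape of [f]. *)
Definition pderiv w f g := smooth_field f /\ eq_fieldOn (pd w f) g.

Lemma pderiv_dx i f : smooth_field f -> pderiv (ex i) f (dX i f).
Proof. by rewrite dxE. Qed.

Lemma pderiv_dy i f : smooth_field f -> pderiv (ey i) f (dY i f).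
Proof. by rewrite dyE. Qed.

Lemma pderiv_cst w (c : R) : pderiv w (fun _ _ => c) (fun _ _ => 0).
Proof.
split; first exact: smooth_on_cst.
by move=> x y _; exact: derive_cst.
Qed.

Lemma pderivD w f f' g g' : pderiv w f f' -> pderiv w g g' ->
  pderiv w (fun x y => f x y + g x y) (fun x y => f' x y + g' x y).
Proof.
move=> [sf ff'] [sg gg']; split; first exact: smooth_onD.
move=> x y Dxy; rewrite -ff'// -gg'//.
by apply: deriveD; exact: smooth_field_derivable.
Qed.

Lemma pderivN w f f' : pderiv w f f' ->
  pderiv w (fun x y => - f x y) (fun x y => - f' x y).
Proof.
move=> [sf ff']; split; first exact: smooth_onN.
move=> x y Dxy; rewrite -ff'//.
by apply: deriveN; exact: smooth_field_derivable.
Qed.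

Lemma pderivM w f f' g g' : pderiv w f f' -> pderiv w g g' ->
  pderiv w (fun x y => f x y * g x y)
           (fun x y => f' x y * g x y + f x y * g' x y).
Proof.
move=> [sf ff'] [sg gg']; split; first exact: smooth_onM.
move=> x y Dxy; rewrite -ff'// -gg'// addrC [_ * g x y]mulrC.
by apply: deriveM; exact: smooth_field_derivable.
Qed.

Lemma pderiv_sum w (I : finType) (F F' : I -> field R n) :
  (forall a : I, pderiv w (F a) (F' a)) ->
  pderiv w (fun x y => \sum_a F a x y) (fun x y => \sum_a F' a x y).
Proof.
move=> dF.
have H (s : seq I) : pderiv w (fun x y => \sum_(a <- s) F a x y)
    (fun x y => \sum_(a <- s) F' a x y).
  elim: s => [|a s IHs].
    under eq_fun do under eq_fun do rewrite big_nil.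
    under [X in pderiv _ _ X]eq_fun do under eq_fun do rewrite big_nil.
    exact: pderiv_cst.
  under eq_fun do under eq_fun do rewrite big_cons.
  under [X in pderiv _ _ X]eq_fun do under eq_fun do rewrite big_cons.
  exact: pderivD.
exact: H.
Qed.

Lemma pderiv_coord w i : pderiv w (fun x y => y 0 i) (fun _ _ => w.2 0 i).
Proof.
have lin : linear (fun z : V * V => z.2 0 i : R).
  by move=> c u v; rewrite /= !mxE.
pose L := GRing.isLinear.Build _ _ _ _ _ lin.
pose f : {linear (V * V)%type -> R} := HB.pack (fun z : V * V => z.2 0 i : R) L.
have cf : continuous f.
  move=> u; apply: (@continuous_comp _ _ _ snd (fun v : V => v 0 i)).
    exact: cvg_snd.
  exact: coord_continuous.
have df v z : 'D_v f z = v.2 0 i.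
  by rewrite deriveE ?diff_lin//; exact: linear_differentiable.
split; last by move=> x y _; exact: df.
case=> [z _|k]; first exact: cf.
split=> [z _|v]; first exact: (@linear_differentiable _ _ _ f).
apply: (@Ck_on_eq _ _ _ k D (cst (v.2 0 i))) => //; last exact: Ck_on_cst.
Qed.

Lemma dy_pderiv k f g x y : pderiv (ey k) f g -> D (x, y) -> dY k f x y = g x y.
Proof. by rewrite dyE => -[_]; exact. Qed.

Lemma dx_pderiv k f g x y : pderiv (ex k) f g -> D (x, y) -> dX k f x y = g x y.
Proof. by rewrite dxE => -[_]; exact. Qed.

Lemma pdC w w' f : smooth_field f ->
  eq_fieldOn (pd w (pd w' f)) (pd w' (pd w f)).
Proof.
move=> sf x y Dxy.
have pdE u u' : pd u (pd u' f) x y =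
    'D_u (fun z => 'D_u' (fun z : V * V => f z.1 z.2) z) (x, y).
  by congr ('D_u _ _); apply/funext => -[].
by rewrite !pdE; exact: derive_comm (sf 2%N) Dxy.
Qed.

Lemma dyC i j f : smooth_field f -> eq_fieldOn (dY i (dY j f)) (dY j (dY i f)).
Proof. by rewrite !dyE; exact: pdC. Qed.

Lemma dydxC i j f : smooth_field f ->
  eq_fieldOn (dY i (dX j f)) (dX j (dY i f)).
Proof. by rewrite !dyE !dxE; exact: pdC. Qed.

(** An iterated vertical derivative is encoded by its list of indices, outermost first; symmetry in
    the indices then becomes invariance under permutation of the list. *)
Definition dyn (s : seq 'I_n) f := foldr dY f s.

Lemma smooth_dyn s f : smooth_field f -> smooth_field (dyn s f).
Proof. by move=> sf; elim: s => //= i s; exact: smooth_dy. Qed.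

(** The head of [s] is located inside [t] and commuted outwards past the entries before it, by
    Schwarz; the tails agree by induction. *)
Lemma dyn_perm s t f : smooth_field f -> perm_eq s t ->
  eq_fieldOn (dyn s f) (dyn t f).
Proof.
move=> sf; elim: s t => [|i s IHs] t pst.
  by move: pst; rewrite perm_sym => /perm_nilP ->.
have /path.splitPr it : i \in t by rewrite -(perm_mem pst) mem_head.
case: it pst => t1 t2.
rewrite -(cat1s i t2) perm_sym perm_catCA /= perm_cons perm_sym.
move=> /IHs st x y Dxy; rewrite [LHS](dy_congr i st)//.
elim: t1 {st} x y Dxy => [//|j t1 IHt] x y Dxy.
rewrite [LHS]dyC//; last exact: smooth_dyn.
exact: dy_congr IHt _ _ Dxy.
Qed.

Lemma dyn_dxC s k f : smooth_field f ->
  eq_fieldOn (dyn s (dX k f)) (dX k (dyn s f)).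
Proof.
move=> sf; elim: s => [//|i s IHs] x y Dxy.
transitivity (dY i (dX k (dyn s f)) x y); first exact: dy_congr IHs _ _ Dxy.
by apply: dydxC => //; exact: smooth_dyn.
Qed.

Lemma dydydxC i j k f : smooth_field f ->
  eq_fieldOn (dY i (dY j (dX k f))) (dX k (dY i (dY j f))).
Proof. exact: dyn_dxC [:: i; j] k f. Qed.

(** * Euler's relation, the infinitesimal form of homogeneity of degree [c] in [y] *)

Definition euler (c : R) f :=
  eq_fieldOn (fun x y => \sum_m y 0 m * dY m f x y) (fun x y => c * f x y).

Lemma sum_delta i (u : 'I_n -> R) : \sum_m (m == i)%:R * u m = u i.
Proof.
rewrite (bigD1 i)//= eqxx mul1r big1 ?addr0// => m /negPf ->.
by rewrite mul0r.
Qed.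

Lemma delta_coord i m : (delta_mx 0 i : V) 0 m = (m == i)%:R.
Proof. by rewrite mxE eqxx. Qed.

(** Differentiating Euler's relation along [y^i] also hits the factor [y^m]; the Kronecker delta
    leaves one extra [dY i f], which lowers the degree by one. *)
Lemma euler_dy c i f : smooth_field f -> euler c f -> euler (c - 1) (dY i f).
Proof.
move=> sf ef x y Dxy; have := dy_congr i ef Dxy.
rewrite (dy_pderiv (pderiv_sum (fun m => pderivM (pderiv_coord _ m)
  (pderiv_dy i (smooth_dy m sf)))) Dxy).
rewrite (dy_pderiv (pderivM (pderiv_cst _ c) (pderiv_dy i sf)) Dxy).
rewrite big_split /=.
under eq_bigr do rewrite delta_coord.
rewrite sum_delta mul0r add0r => E.
rewrite mulrBl mul1r -E addrAC subrr add0r.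
by apply: eq_bigr => m _; rewrite dyC.
Qed.

Lemma euler_dx c i f : smooth_field f -> euler c f -> euler c (dX i f).
Proof.
move=> sf ef x y Dxy; have := dx_congr i ef Dxy.
rewrite (dx_pderiv (pderiv_sum (fun m => pderivM (pderiv_coord _ m)
  (pderiv_dx i (smooth_dy m sf)))) Dxy).
rewrite (dx_pderiv (pderivM (pderiv_cst _ c) (pderiv_dx i sf)) Dxy).
rewrite mul0r add0r => <-.
by apply: eq_bigr => m _; rewrite mxE mul0r add0r dydxC.
Qed.

Lemma eulerM c c' f g : smooth_field f -> smooth_field g -> euler c f ->
  euler c' g -> euler (c + c') (fun x y => f x y * g x y).
Proof.
move=> sf sg ef eg x y Dxy.
have E m := dy_pderiv (pderivM (pderiv_dy m sf) (pderiv_dy m sg)) Dxy.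
under eq_bigr do rewrite E mulrDr mulrA mulrCA.
rewrite big_split /= -mulr_suml -mulr_sumr ef// eg//; ring.
Qed.

Lemma eulerD c f g : smooth_field f -> smooth_field g -> euler c f ->
  euler c g -> euler c (fun x y => f x y + g x y).
Proof.
move=> sf sg ef eg x y Dxy.
have E m := dy_pderiv (pderivD (pderiv_dy m sf) (pderiv_dy m sg)) Dxy.
under eq_bigr do rewrite E mulrDr.
by rewrite big_split /= ef// eg//; ring.
Qed.

Lemma euler_cst (c : R) : euler 0 (fun _ _ => c).
Proof.
move=> x y Dxy; rewrite mul0r big1// => m _.
by rewrite (dy_pderiv (pderiv_cst _ c) Dxy) mulr0.
Qed.

Lemma eulerN c f : smooth_field f -> euler c f -> euler c (fun x y => - f x y).
Proof.
move=> sf ef x y Dxy.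
have E m := dy_pderiv (pderivN (pderiv_dy m sf)) Dxy.
under eq_bigr do rewrite E mulrN.
by rewrite sumrN ef// mulrN.
Qed.

Lemma smooth_coord i : smooth_field (fun x y => y 0 i).
Proof. by have [] := pderiv_coord 0 i. Qed.

Lemma euler_coord i : euler 1 (fun x y => y 0 i).
Proof.
move=> x y Dxy.
have E m := dy_pderiv (pderiv_coord (ey m) i) Dxy.
under eq_bigr do rewrite E delta_coord eq_sym mulrC.
by rewrite sum_delta mul1r.
Qed.

Lemma euler_sum c (I : finType) (F : I -> field R n) :
  (forall a, smooth_field (F a)) -> (forall a, euler c (F a)) ->
  euler c (fun x y => \sum_a F a x y).
Proof.
move=> sF eF x y Dxy.
have E m := dy_pderiv (pderiv_sum (fun a => pderiv_dy m (sF a))) Dxy.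
under eq_bigr do rewrite E mulr_sumr.
by rewrite exchange_big /= mulr_sumr; apply: eq_bigr => a _; exact: eF.
Qed.


(** The Euler sum is the derivative of [f] in direction [(0, y)]. For small nonzero [h] the factor
    [h + 1] is positive, so by homogeneity the difference quotient along the ray is constantly
    [f x y]. *)
Lemma euler_homogeneous f : smooth_field f ->
  (forall x y t, D (x, y) -> 0 < t -> f x (t *: y) = t * f x y) -> euler 1 f.
Proof.
move=> sf hf x y Dxy; rewrite mul1r.
have df := smooth_field_differentiable sf Dxy.
transitivity ('D_(0, y) (fun z : V * V => f z.1 z.2) (x, y)).
  rewrite deriveE// (_ : (0, y) = \sum_m y 0 m *: ey m); last first.
    rewrite [RHS]surjective_pairing; congr (_, _).
      by rewrite raddf_sum /= big1// => m _; rewrite scaler0.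
    by rewrite raddf_sum /= -row_sum_delta.
  rewrite linear_sum; apply: eq_bigr => m _.
  by rewrite linearZ /= -deriveE// dyE.
apply: (@cvg_lim); first exact: norm_hausdorff.
apply: cvg_near_cst.
near=> h; rewrite /= scaler0 add0r.
have -> : h *: y + y = (h + 1) *: y by rewrite scalerDl scale1r.
have h1 : 0 < h + 1.
  have : `|h| < 1 by near: h; apply: dnbhs0_lt.
  by rewrite ltr_norml => /andP[]; lra.
have h0 : h != 0 by near: h; exact: nbhs_dnbhs_neq.
rewrite hf//; apply/eqP; rewrite -[_ *: _]/(_ * _); apply/eqP; field.
exact: h0.
Unshelve. all: by end_near. Qed.

End Fields.

(** * Curvature of a spray *)

Ltac solve_smooth :=
  lazymatch goal with
  | |- smooth_field _ (dX _ _) => apply: smooth_dx; solve_smooth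
  | |- smooth_field _ (dY _ _) => apply: smooth_dy; solve_smooth
  | |- smooth_field ?D (fun x y => ?f x y) =>
      change (smooth_field D f); solve_smooth
  | _ => by auto
  end.

(** Meant for a goal whose derivative is an existential variable: recursion on the shape of the
    function fills it in. *)
Ltac solve_pderiv :=
  lazymatch goal with
  | |- pderiv _ _ (fun x y => @?f x y + @?g x y) _ =>
      eapply pderivD; try assumption; solve_pderiv
  | |- pderiv _ _ (fun x y => - @?f x y) _ =>
      eapply pderivN; try assumption; solve_pderiv
  | |- pderiv _ _ (fun x y => @?f x y * @?g x y) _ =>
      eapply pderivM; try assumption; solve_pderiv
  | |- pderiv _ _ (fun x y => \sum_a @?f x y a) _ =>
      eapply pderiv_sum; try assumption;
      let m := fresh "m" in intro m; solve_pderiv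
  | |- pderiv _ _ (fun x y => fun_of_matrix y _ ?i) _ =>
      eapply pderiv_coord; try assumption
  | |- pderiv _ _ (fun _ _ => ?c) _ => eapply pderiv_cst; try assumption
  | |- pderiv ?D ?w (fun x y => ?f x y) ?g =>
      change (pderiv D w f g); solve_pderiv
  | |- pderiv _ (ex _ _) _ _ => eapply pderiv_dx; solve_smooth
  | |- pderiv _ (ey _ _) _ _ => eapply pderiv_dy; solve_smooth
  end.

Ltac ring_partials :=
  repeat match goal with
  | |- context [dY ?a ?b ?c ?d] => generalize (dY a b c d); intro
  | |- context [dX ?a ?b ?c ?d] => generalize (dX a b c d); intro
  end; ring.

Section SprayCurvature.
Variables (R : realType) (n : nat).
Local Notation V := 'rV[R]_n.
Variable D : set (V * V).
Hypothesis oD : open D.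
Variable H : 'I_n -> field R n.
Hypothesis sH : forall i, smooth_field D (H i).
Implicit Types (i j k l m p r : 'I_n).

Let B := berwald H.

(** Here [g] may stay an existential variable: [solve_pderiv] determines it in the first premise,
    and the last premise compares it with the wanted value. *)
Lemma dY_eq k f g x y v : pderiv D (ey R k) f g -> D (x, y) -> g x y = v ->
  dY k f x y = v.
Proof. by move=> fg Dxy <-; exact: dy_pderiv fg Dxy. Qed.

Lemma riemann_pderiv i k l x y : D (x, y) ->
  dY l (riemann H i k) x y =
    2 * dX k (dY l (H i)) x y - \sum_m dX m (dY l (dY k (H i))) x y * y 0 m
    - dX l (dY k (H i)) x y
    + 2 * (\sum_m (dY l (H m) x y * dY k (dY m (H i)) x y
                   + H m x y * dY l (dY k (dY m (H i))) x y))
    - \sum_m (dY l (dY m (H i)) x y * dY k (H m) x y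
              + dY m (H i) x y * dY l (dY k (H m)) x y).
Proof.
move=> Dxy; rewrite /riemann dX_def dY_def.
eapply dY_eq; [solve_pderiv|exact: Dxy|cbv beta].
have -> : \sum_m (dY l (dY k (dX m (H i))) x y * y 0 m +
    dY k (dX m (H i)) x y * (ey R l).2 0 m) =
    \sum_m dX m (dY l (dY k (H i))) x y * y 0 m + dX l (dY k (H i)) x y.
  rewrite big_split; apply: (f_equal2 +%R).
    by apply: eq_bigr => m _; rewrite (dydydxC oD).
  under eq_bigr do rewrite delta_coord mulrC.
  by rewrite sum_delta (dydxC oD).
by rewrite (dydxC oD l k (sH i) Dxy) !mul0r !add0r opprD addrA.
Qed.

(** Antisymmetrizing in [k] and [l] cancels the terms symmetric in them; every other term occurs
    three times, which absorbs the factor [3^-1]. *)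
Lemma riemann3E i k l : eq_fieldOn D (riemann3 H i k l) (fun x y =>
  dX k (dY l (H i)) x y - dX l (dY k (H i)) x y
  + \sum_m (dY l (H m) x y * dY k (dY m (H i)) x y
            - dY k (H m) x y * dY l (dY m (H i)) x y)).
Proof.
move=> x y Dxy; rewrite /riemann3 dY_def !riemann_pderiv//.
have E1 : \sum_m dX m (dY k (dY l (H i))) x y * y 0 m =
    \sum_m dX m (dY l (dY k (H i))) x y * y 0 m.
  apply: eq_bigr => m _.
  have Q := dx_congr oD m (dyC oD k l (sH i)) Dxy.
  move: Q => /(congr1 (fun t => t * y 0 m)).
  exact.
rewrite E1 !big_split /= sumrN.
have -> : \sum_m H m x y * dY k (dY l (dY m (H i))) x y =
          \sum_m H m x y * dY l (dY k (dY m (H i))) x y.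
  by apply: eq_bigr => m _; rewrite (dyC oD)//; exact: smooth_dy.
have -> : \sum_m dY m (H i) x y * dY k (dY l (H m)) x y =
          \sum_m dY m (H i) x y * dY l (dY k (H m)) x y.
  by apply: eq_bigr => m _; rewrite (dyC oD).
have C a b : \sum_m dY a (dY m (H i)) x y * dY b (H m) x y =
    \sum_m dY b (H m) x y * dY a (dY m (H i)) x y.
  by apply: eq_bigr => m _; rewrite mulrC.
have alg (a b s t t' u v w w' : R) : w = t' -> w' = t ->
    3^-1 * (2 * a - s - b + 2 * (t + u) - (w + v)
    - (2 * b - s - a + 2 * (t' + u) - (w' + v))) = a - b + (t - t').
  by move=> -> ->; field.
by apply: alg; exact: C.
Qed.

Lemma riemann4E i j k l : eq_fieldOn D (riemann4 H i j k l) (fun x y =>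
  dY j (dX k (dY l (H i))) x y - dY j (dX l (dY k (H i))) x y
  + \sum_m (dY j (dY l (H m)) x y * dY k (dY m (H i)) x y
            + dY l (H m) x y * dY j (dY k (dY m (H i))) x y
            - (dY j (dY k (H m)) x y * dY l (dY m (H i)) x y
               + dY k (H m) x y * dY j (dY l (dY m (H i))) x y))).
Proof.
move=> x y Dxy; rewrite /riemann4 dY_def (dy_congr oD j (@riemann3E i k l) Dxy).
by eapply dY_eq; [solve_pderiv|exact: Dxy|].
Qed.

Lemma horizontal_derivativeE G (T : 'I_n -> 'I_n -> 'I_n -> 'I_n -> field R n)
    i j k l m x y :
  horizontal_derivative G T i j k l m x y = dX m (T i j k l) x y +
  \sum_r (- (dY m (G r) x y * dY r (T i j k l) x y)
          + dY m (dY r (G i)) x y * T r j k l x y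
          - dY m (dY j (G r)) x y * T i r k l x y
          - dY m (dY k (G r)) x y * T i j r l x y
          - dY m (dY l (G r)) x y * T i j k r x y).
Proof.
rewrite /horizontal_derivative /spray1 /spray2 dX_def dY_def.
by rewrite !big_split /= !sumrN !addrA.
Qed.

Let permE s t i x y : D (x, y) -> perm_eq s t ->
  dyn s (H i) x y = dyn t (H i) x y.
Proof. by move=> Dxy st; exact: (dyn_perm oD (sH i) st Dxy). Qed.

(** Brings derivatives with the same indices into one common order, so that [ring] sees equal atoms.
    The permutation is checked by counting occurrences. *)
Ltac perm_dy i s t x y Dxy :=
  let E := fresh in
  have E : dyn s (H i) x y = dyn t (H i) x y;
  [by apply: permE Dxy _; apply/seq.permP => ? /=; ring
  |rewrite /dyn /= in E; rewrite {}E].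

Let permE_dX s t i k x y : D (x, y) -> perm_eq s t ->
  dX k (dyn s (H i)) x y = dX k (dyn t (H i)) x y.
Proof.
by move=> Dxy st; exact: (dx_congr oD k (dyn_perm oD (sH i) st) Dxy).
Qed.

(** The Bianchi identity. The [x]-derivatives match directly; the products match the connection
    terms one [r] at a time, while the two terms carrying [H^r_{kl}] cancel each other. *)
Lemma dy_riemann4 i j k l p : eq_fieldOn D (dY p (riemann4 H i j k l))
  (fun x y => horizontal_derivative H B i j l p k x y
              - horizontal_derivative H B i j k p l x y).
Proof.
move=> x y Dxy; rewrite (dy_congr oD p (@riemann4E i j k l) Dxy).
eapply dY_eq; [solve_pderiv|exact: Dxy|cbv beta].
rewrite !horizontal_derivativeE opprD addrACA -sumrB.
apply: (f_equal2 +%R); first apply: (f_equal2 (fun a b => a - b)).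
- rewrite (dydydxC oD p j k (smooth_dy oD l (sH i)) Dxy) /B /berwald dY_def.
  by apply: (@permE_dX [:: p; j; l] [:: p; l; j]) => //;
    apply/seq.permP => ? /=; ring.
- rewrite (dydydxC oD p j l (smooth_dy oD k (sH i)) Dxy) /B /berwald dY_def.
  by apply: (@permE_dX [:: p; j; k] [:: p; k; j]) => //;
    apply/seq.permP => ? /=; ring.
apply: eq_bigr => r _; rewrite /B /berwald dY_def.
perm_dy r [:: p; j; l] [:: p; l; j] x y Dxy.
perm_dy r [:: p; j; k] [:: p; k; j] x y Dxy.
perm_dy i [:: p; j; k; r] [:: r; p; k; j] x y Dxy.
perm_dy i [:: p; j; l; r] [:: r; p; l; j] x y Dxy.
perm_dy r [:: j; l] [:: l; j] x y Dxy.
perm_dy r [:: p; l] [:: l; p] x y Dxy.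
perm_dy r [:: j; k] [:: k; j] x y Dxy.
perm_dy r [:: p; k] [:: k; p] x y Dxy.
perm_dy r [:: l; k] [:: k; l] x y Dxy.
perm_dy i [:: j; k; r] [:: r; k; j] x y Dxy.
perm_dy i [:: j; l; r] [:: r; l; j] x y Dxy.
ring_partials.
Qed.

(** * Consequences of the 2-homogeneity of the spray *)

Hypothesis eH : forall i, euler D 2 (H i).

Let euler_spray1 i j : euler D 1 (dY j (H i)).
Proof.
have := euler_dy oD j (sH i) (@eH i).
by rewrite (_ : 2 - 1 = 1 :> R)//; ring.
Qed.

Let euler_spray2 i j k : euler D 0 (dY k (dY j (H i))).
Proof.
have := euler_dy oD k (smooth_dy oD j (sH i)) (@euler_spray1 i j).
by rewrite subrr.
Qed.

Let euler_spray3 i j k l : euler D (-1) (dY l (dY k (dY j (H i)))).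
Proof.
have := euler_dy oD l (smooth_dy oD k (smooth_dy oD j (sH i)))
  (@euler_spray2 i j k).
by rewrite add0r.
Qed.

(** Euler's relations evaluate the contracted connection coefficients: [H^r_m y^m = 2 H^r] and
    [H^r_{jm} y^m = H^r_j]. They are applied from right to left, expanding each coefficient into a
    sum over [m]. *)
Lemma horizontal_derivative0E (T : 'I_n -> 'I_n -> 'I_n -> 'I_n -> field R n)
    i j k l x y : D (x, y) ->
  horizontal_derivative0 H T i j k l x y = \sum_m dX m (T i j k l) x y * y 0 m +
  \sum_r (- (2 * H r x y * dY r (T i j k l) x y)
          + dY r (H i) x y * T r j k l x y
          - dY j (H r) x y * T i r k l x y
          - dY k (H r) x y * T i j r l x y
          - dY l (H r) x y * T i j k r x y).
Proof.
move=> Dxy; rewrite /horizontal_derivative0.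
under eq_bigr do rewrite horizontal_derivativeE mulrDl mulr_suml.
rewrite big_split; apply: (f_equal2 +%R) => //.
rewrite exchange_big; apply: eq_bigr => r _.
have F c f : euler D c f -> \sum_m dY m f x y * y 0 m = c * f x y.
  by move=> <-//; apply: eq_bigr => m _; rewrite mulrC.
rewrite -(F _ _ (@eH r)) -[X in X * T r j k l x y]mul1r.
rewrite -(F _ _ (@euler_spray1 i r)).
rewrite -[dY j (H r) x y]mul1r -(F _ _ (@euler_spray1 r j)).
rewrite -[dY k (H r) x y]mul1r -(F _ _ (@euler_spray1 r k)).
rewrite -[dY l (H r) x y]mul1r -(F _ _ (@euler_spray1 r l)).
rewrite !mulr_suml -!sumrN -!big_split /=.
by apply: eq_bigr => m _; ring_partials.
Qed.

Let euler_sumE c f x y : D (x, y) -> euler D c f ->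
  \sum_m dY m f x y * y 0 m = c * f x y.
Proof. by move=> Dxy <-//; apply: eq_bigr => m _; rewrite mulrC. Qed.

(** Invariantly, [y] is horizontally parallel and [B] is annihilated by [y], so the contraction is
    the horizontal derivative of zero. *)
Lemma horizontal_berwald_radial i j k l x y : D (x, y) ->
  \sum_m horizontal_derivative H B i j m k l x y * y 0 m = 0.
Proof.
move=> Dxy.
under eq_bigr do rewrite horizontal_derivativeE mulrDl mulr_suml.
rewrite big_split /= exchange_big /= /B /berwald dY_def -[RHS]addr0.
apply: (f_equal2 +%R).
  have sB := smooth_dy oD k (smooth_dy oD j (sH i)).
  rewrite -[RHS](mul0r (dX l (dY k (dY j (H i))) x y)).
  rewrite -(euler_sumE Dxy (euler_dx oD l sB (@euler_spray2 i j k))).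
  apply: eq_bigr => m _; rewrite (dydxC oD m l sB Dxy).
  rewrite (@permE_dX [:: k; m; j] [:: m; k; j])//.
  by apply/seq.permP => ? /=; ring.
apply: big1 => r _.
transitivity (\sum_m (
  - (dY l (H r) x y * (dY m (dY r (dY k (dY j (H i)))) x y * y 0 m))
  + dY l (dY r (H i)) x y * (dY m (dY k (dY j (H r))) x y * y 0 m)
  - dY l (dY j (H r)) x y * (dY m (dY k (dY r (H i))) x y * y 0 m)
  - dY m (dY l (H r)) x y * y 0 m * dY k (dY r (dY j (H i))) x y
  - dY l (dY k (H r)) x y * (dY m (dY r (dY j (H i))) x y * y 0 m))).
  apply: eq_bigr => m _.
  perm_dy i [:: r; k; m; j] [:: m; r; k; j] x y Dxy.
  perm_dy r [:: k; m; j] [:: m; k; j] x y Dxy.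
  perm_dy i [:: k; m; r] [:: m; k; r] x y Dxy.
  perm_dy r [:: l; m] [:: m; l] x y Dxy.
  perm_dy i [:: r; m; j] [:: m; r; j] x y Dxy.
  ring_partials.
(* Three of the five sums vanish because second derivatives of [H] have degree 0. In the first, [B]
   has degree -1 and gives [+ H^r_l B], which cancels the fourth. *)
rewrite !big_split /= !sumrN -!mulr_sumr -!mulr_suml.
rewrite !(euler_sumE Dxy (@euler_spray2 _ _ _)).
rewrite (euler_sumE Dxy (@euler_spray1 _ _)).
rewrite (euler_sumE Dxy (@euler_spray3 _ _ _ _)).
perm_dy i [:: r; k; j] [:: k; r; j] x y Dxy.
ring_partials.
Qed.

(** The tensor [S] of the overview: the derivative [|0] of [B_j^i_{kl.q}], treated as having four
    lower indices, in the form of [horizontal_derivative0E]. *)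
Let S i j k l q x y :=
  \sum_m dX m (dY q (dY l (dY k (dY j (H i))))) x y * y 0 m +
  \sum_r (- (2 * H r x y * dY r (dY q (dY l (dY k (dY j (H i))))) x y)
          + dY r (H i) x y * dY q (dY l (dY k (dY j (H r)))) x y
          - dY j (H r) x y * dY q (dY l (dY k (dY r (H i)))) x y
          - dY k (H r) x y * dY q (dY l (dY r (dY j (H i)))) x y
          - dY l (H r) x y * dY q (dY r (dY k (dY j (H i)))) x y
          - dY q (H r) x y * dY r (dY l (dY k (dY j (H i)))) x y).

(** The terms with coefficients [H^r_k] and [H^r_q] trade places; all others only reorder vertical
    derivatives. *)
Let S_sym i j k l q x y : D (x, y) -> S i j k l q x y = S i j q l k x y.
Proof.
move=> Dxy; rewrite /S; apply: (f_equal2 +%R).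
  apply: eq_bigr => m _.
  rewrite (@permE_dX [:: q; l; k; j] [:: k; l; q; j])//.
  by apply/seq.permP => ? /=; ring.
apply: eq_bigr => r _.
perm_dy i [:: r; q; l; k; j] [:: r; k; l; q; j] x y Dxy.
perm_dy r [:: q; l; k; j] [:: k; l; q; j] x y Dxy.
perm_dy i [:: q; l; k; r] [:: k; l; q; r] x y Dxy.
perm_dy i [:: q; l; r; j] [:: r; l; q; j] x y Dxy.
perm_dy i [:: q; r; k; j] [:: k; r; q; j] x y Dxy.
perm_dy i [:: r; l; k; j] [:: k; l; r; j] x y Dxy.
ring_partials.
Qed.

(** Differentiating [y^m] and the coefficients yields [B_{|q}], differentiating [B] yields [S],
    except that [-2 H^r_q B_{.r}] is shared equally: one half belongs to [B_{|q}], the other is the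
    connection term of [S] for its fourth lower index [q]. *)
Lemma dy_horizontal_derivative0 i j k l q x y : D (x, y) ->
  dY q (horizontal_derivative0 H B i j k l) x y =
  horizontal_derivative H B i j k l q x y + S i j k l q x y.
Proof.
move=> Dxy.
rewrite (dy_congr oD q (fun x y => @horizontal_derivative0E B i j k l x y) Dxy).
rewrite /B /berwald dY_def.
eapply dY_eq; [solve_pderiv|exact: Dxy|cbv beta].
rewrite horizontal_derivativeE /S.
have -> : \sum_m (dY q (dX m (dY l (dY k (dY j (H i))))) x y * y 0 m
      + dX m (dY l (dY k (dY j (H i)))) x y * (ey R q).2 0 m) =
    \sum_m dX m (dY q (dY l (dY k (dY j (H i))))) x y * y 0 m
    + dX q (dY l (dY k (dY j (H i)))) x y.
  rewrite big_split; apply: (f_equal2 +%R).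
    by apply: eq_bigr => m _; rewrite (dydxC oD)//; solve_smooth.
  under eq_bigr do rewrite delta_coord mulrC.
  by rewrite sum_delta.
rewrite addrACA [X in _ = X + _]addrC -big_split.
apply: (f_equal2 +%R) => //; apply: eq_bigr => r _ /=.
perm_dy i [:: q; r; l; k; j] [:: r; q; l; k; j] x y Dxy.
ring_partials.
Qed.

Lemma dy_riemann4_eq0 :
  (forall x y, D (x, y) -> forall i j k l m,
     dy m (riemann4 H i j k l) x y = 0) <->
  (forall x y, D (x, y) -> forall i j k l,
     horizontal_derivative0 H B i j k l x y = 0).
Proof.
rewrite dY_def; split=> [R0|B0] x y Dxy i j k l.
  (* Zero is written as the contraction of [y] with the second lower slot; by the Bianchi identity,
     [R0] lets that slot be exchanged with the index of differentiation. *)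
  rewrite -[RHS](@horizontal_berwald_radial i j l k x y Dxy).
  apply: eq_bigr => m _.
  suff -> : horizontal_derivative H B i j k l m x y =
    horizontal_derivative H B i j m l k x y by [].
  by apply: subr0_eq; rewrite -dy_riemann4// R0.
move=> p; rewrite dy_riemann4//.
(* The hypothesis holds on all of the open set [D], so it may be differentiated vertically; [B_{|c}]
   then inherits the symmetry of [S]. *)
have HS a b c : horizontal_derivative H B i j a b c x y = - S i j a b c x y.
  apply/eqP; rewrite -addr_eq0 -dy_horizontal_derivative0//.
  rewrite (dy_congr oD c (g := fun _ _ => 0) _ Dxy); last first.
    by move=> x' y' Dxy'; exact: B0.
  by rewrite (dy_pderiv (pderiv_cst oD _ 0) Dxy).
by rewrite !HS (S_sym i j l p k Dxy) subrr.
Qed.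

Lemma berwald_euler i j k l x y : D (x, y) ->
  \sum_r dY r (B i j k l) x y * y 0 r = - B i j k l x y.
Proof.
move=> Dxy; rewrite /B /berwald dY_def.
by rewrite (euler_sumE Dxy (@euler_spray3 i j k l)) mulN1r.
Qed.

(** Euler's relation in degree 0 for second derivatives of [H i] settles the last slot; symmetry of
    [B] carries it to the other two. *)
Lemma berwald_radial i j k l x y : D (x, y) ->
  [/\ \sum_r B i r k l x y * y 0 r = 0, \sum_r B i j r l x y * y 0 r = 0
    & \sum_r B i j k r x y * y 0 r = 0].
Proof.
move=> Dxy; rewrite /B /berwald dY_def.
have E a b : \sum_r dY r (dY b (dY a (H i))) x y * y 0 r = 0.
  by rewrite (euler_sumE Dxy (@euler_spray2 i a b)) mul0r.
split=> //.
- rewrite -[RHS](E k l); apply: eq_bigr => r _.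
  by perm_dy i [:: l; k; r] [:: r; l; k] x y Dxy.
- rewrite -[RHS](E j l); apply: eq_bigr => r _.
  by perm_dy i [:: l; r; j] [:: r; l; j] x y Dxy.
Qed.

End SprayCurvature.

(** * Passing from the spray [G] to [G - rho y] *)

Section ProjectiveSpray.
Variables (R : realType) (n : nat).
Local Notation V := 'rV[R]_n.
Variable D : set (V * V).
Hypothesis oD : open D.
Variables (G : 'I_n -> field R n) (rho : field R n).
Hypothesis sG : forall i, smooth_field D (G i).
Hypothesis eG : forall i, euler D 2 (G i).
Hypothesis srho : smooth_field D rho.
Hypothesis erho : euler D 1 rho.
Let H := projective_spray rho G.
Implicit Types (i j k l m p r : 'I_n).

Lemma projective_spray_smooth i : smooth_field D (H i).
Proof.
apply: smooth_onB; first exact: oD.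
  exact: sG.
by apply: smooth_onM; [exact: oD|exact: srho|exact: (smooth_coord oD i)].
Qed.

Lemma projective_spray_euler i : euler D 2 (H i).
Proof.
have sy := smooth_coord oD i; have sry := smooth_onM oD srho sy.
apply: (eulerD oD (sG i) (smooth_onN oD sry) (@eG i)).
apply: (eulerN oD sry).
by rewrite (_ : 2 = 1 + 1 :> R)//; apply: eulerM => //; exact: euler_coord.
Qed.

Lemma dY_projective_spray i j x y : D (x, y) ->
  dY j (H i) x y =
  dY j (G i) x y - (dY j rho x y * y 0 i + rho x y * (i == j)%:R).
Proof.
move=> Dxy; rewrite /H /projective_spray.
by eapply (@dY_eq R n D); [solve_pderiv|exact: Dxy|rewrite delta_coord].
Qed.

Lemma horizontal_berwald_projective i j k l x y : D (x, y) ->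
  horizontal_derivative0 G (berwald H) i j k l x y
  - \sum_r dy r rho x y * berwald H r j k l x y * y 0 i
  = horizontal_derivative0 H (berwald H) i j k l x y.
Proof.
move=> Dxy.
have sH := projective_spray_smooth; have eH := projective_spray_euler.
rewrite (horizontal_derivative0E oD sG eG)//.
rewrite (horizontal_derivative0E oD sH eH)// dY_def.
have eB := berwald_euler oD sH eH i j k l Dxy.
have [rj rk rl] := berwald_radial oD sH eH i j k l Dxy.
(* From here on [B] is known only through its degree -1 and its three vanishing contractions with
   [y]. *)
move: (berwald H) eB rj rk rl => B eB rj rk rl.
rewrite -addrA -sumrN -big_split; apply: (f_equal2 +%R) => //=.
under [RHS]eq_bigr do rewrite !dY_projective_spray//.
pose t r := - (2 * G r x y * dY r (B i j k l) x y)
  + dY r (G i) x y * B r j k l x y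
  - dY j (G r) x y * B i r k l x y - dY k (G r) x y * B i j r l x y
  - dY l (G r) x y * B i j k r x y - dY r rho x y * B r j k l x y * y 0 i.
rewrite -[LHS]/(\sum_r t r).
(* After summation the terms with a derivative of [rho] and [B] contracted with [y] vanish, and the
   multiples of [rho * B] have coefficients -2, -1, 1, 1, 1, which add up to zero. Only [t]
   remains. *)
transitivity (\sum_r (t r + 2 * rho x y * (dY r (B i j k l) x y * y 0 r)
  - rho x y * ((r == i)%:R * B r j k l x y)
  + dY j rho x y * (B i r k l x y * y 0 r)
  + rho x y * ((r == j)%:R * B i r k l x y)
  + dY k rho x y * (B i j r l x y * y 0 r)
  + rho x y * ((r == k)%:R * B i j r l x y)
  + dY l rho x y * (B i j k r x y * y 0 r)
  + rho x y * ((r == l)%:R * B i j k r x y))).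
  rewrite !big_split /= !sumrN -!mulr_sumr !sum_delta eB rj rk rl; ring.
apply: eq_bigr => r _; rewrite /t /H /projective_spray [i == r]eq_sym; ring.
Qed.

End ProjectiveSpray.

(** * The geodesic spray *)

Section GeodesicSpray.
Variables (R : realType) (n : nat).
Local Notation V := 'rV[R]_n.
Variable D : set (V * V).
Hypothesis oD : open D.

(** The size [p] is independent of the dimension [n] because the statement is also applied to the
    minors in Cramer's rule. *)
Lemma smooth_field_det p (a : 'I_p -> 'I_p -> field R n) :
  (forall i j, smooth_field D (a i j)) ->
  smooth_field D (fun x y => \det (\matrix_(i, j) a i j x y)).
Proof.
move=> sa; rewrite /determinant.
apply: (@smooth_on_sum _ _ _ oD _ _ _ (fun (s : {perm 'I_p}) (z : V * V) =>
  (-1) ^+ s * \prod_i (\matrix_(i, j) a i j z.1 z.2) i (s i))) => s.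
apply: smooth_onM; [exact: oD|exact: smooth_on_cst|].
apply: smooth_on_prod => // i.
by under eq_fun do rewrite mxE; exact: sa.
Qed.

Lemma smooth_field_invmx (a : 'I_n -> 'I_n -> field R n) i j :
  (forall i j, smooth_field D (a i j)) ->
  (forall x y, D (x, y) -> \matrix_(i, j) a i j x y \in unitmx) ->
  smooth_field D (fun x y => invmx (\matrix_(i, j) a i j x y) i j).
Proof.
move=> sa ua; pose A x y := \matrix_(i, j) a i j x y.
apply: (@smooth_fieldW _ _ _ oD (fun x y => (\det (A x y))^-1 *
  ((-1) ^+ (j + i) * \det (\matrix_(k, l) a (lift j k) (lift i l) x y)))).
- move=> x y Dxy; rewrite /invmx ua// !mxE /cofactor; congr (_ * (_ * \det _)).
  by apply/matrixP => k l; rewrite !mxE.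
- apply: smooth_onM; first exact: oD.
  apply: smooth_onV; first exact: oD.
    by move=> [x y] Dxy; rewrite -unitfE -unitmxE; exact: ua.
  exact: smooth_field_det.
apply: smooth_onM; [exact: oD|exact: smooth_on_cst|].
apply: (@smooth_field_det _ (fun k l => a (lift j k) (lift i l))) => k l.
exact: sa.
Qed.

(** Applying the radial derivative to [A *m invmx A = 1] kills the terms where it falls on [A], of
    degree 0. So [A] annihilates [w], column [j] of the radial derivative of the inverse, and [w]
    vanishes as [A] is invertible. *)
Lemma euler_invmx (a : 'I_n -> 'I_n -> field R n) i j :
  (forall i j, smooth_field D (a i j)) -> (forall i j, euler D 0 (a i j)) ->
  (forall x y, D (x, y) -> \matrix_(i, j) a i j x y \in unitmx) ->
  euler D 0 (fun x y => invmx (\matrix_(i, j) a i j x y) i j).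
Proof.
move=> sa ea ua x y Dxy; rewrite mul0r.
pose A x y := \matrix_(i, j) a i j x y.
pose v k l : field R n := fun x y => invmx (A x y) k l.
have sv k l : smooth_field D (v k l) by exact: smooth_field_invmx.
pose w := \col_k \sum_m y 0 m * dY m (v k j) x y.
have Aw : A x y *m w = 0.
  apply/colP => k; rewrite mxE [RHS]mxE.
  have av : eq_fieldOn D (fun x y => \sum_l a k l x y * v l j x y)
      (fun _ _ => (k == j)%:R).
    move=> x' y' Dxy'; have /matrixP/(_ k j) := mulmxV (ua _ _ Dxy').
    by rewrite !mxE => <-; apply: eq_bigr => l _; rewrite mxE.
  have dav m :
      \sum_l (dY m (a k l) x y * v l j x y + a k l x y * dY m (v l j) x y) = 0.
    have := dy_congr oD m av Dxy.
    rewrite (dy_pderiv (pderiv_cst oD _ _) Dxy) => dav0.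
    apply: etrans dav0; apply/esym.
    by eapply (@dY_eq R n D); [solve_pderiv|exact: Dxy|].
  transitivity (\sum_m y 0 m * 0 : R); last first.
    by rewrite big1// => m _; rewrite mulr0.
  under [RHS]eq_bigr => m _ do rewrite -(dav m) mulr_sumr.
  rewrite exchange_big; apply: eq_bigr => l _ /=.
  under [RHS]eq_bigr do rewrite mulrDr mulrA mulrCA.
  rewrite big_split /= -mulr_suml -mulr_sumr (ea k l)// mul0r mul0r add0r.
  by rewrite !mxE.
have : w = 0 by rewrite -(mulKmx (ua _ _ Dxy) w) Aw mulmx0.
by move=> /colP/(_ i); rewrite !mxE.
Qed.

Variable F : field R n.
Hypothesis sF : smooth_field D F.
Hypothesis eF : euler D 1 F.
Hypothesis F_convex : forall x y, D (x, y) ->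
  forall v : 'rV[R]_n, v != 0 -> 0 < (v *m fundamental_tensor F x y *m v^T) 0 0.

Lemma sqf_smooth : smooth_field D (sqf F).
Proof. exact: smooth_onM. Qed.

Lemma sqf_euler : euler D 2 (sqf F).
Proof. by rewrite (_ : 2 = 1 + 1 :> R)//; exact: (eulerM oD sF sF eF eF). Qed.

(** A nonzero row in the kernel would make the positive definite form vanish on a nonzero vector. *)
Lemma fundamental_tensor_unit x y : D (x, y) ->
  fundamental_tensor F x y \in unitmx.
Proof.
move=> Dxy; rewrite -row_free_unit -kermx_eq0; apply/negPn/negP => K0.
have := F_convex Dxy (v := nz_row (kermx (fundamental_tensor F x y))).
rewrite nz_row_eq0 K0 => /(_ isT).
by rewrite (sub_kermxP (nz_row_sub _)) mul0mx mxE ltxx.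
Qed.

(** Degree count: [F^2] has degree 2, so the fundamental tensor and its inverse have degree 0, while
    both terms of the bracket [b] have degree 2. *)
Lemma geodesic_coef_smooth_euler i :
  smooth_field D (geodesic_coef F i) /\ euler D 2 (geodesic_coef F i).
Proof.
have sE := sqf_smooth; have eE := sqf_euler.
pose g i j : field R n := fun x y => 2^-1 * dY i (dY j (sqf F)) x y.
have sg k l : smooth_field D (g k l).
  by apply: smooth_onM; [exact: oD|exact: smooth_on_cst|
    exact: (smooth_dy oD k (smooth_dy oD l sE))].
have eg k l : euler D 0 (g k l).
  rewrite -(addr0 0); apply: eulerM => //; first exact: smooth_on_cst.
  - exact: (smooth_dy oD k (smooth_dy oD l sE)).
  - exact: euler_cst.
  - have := euler_dy oD k (smooth_dy oD l sE) (euler_dy oD l sE eE).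
    by rewrite (_ : 2 - 1 - 1 = 0 :> R)//; ring.
have gE x y : fundamental_tensor F x y = \matrix_(i, j) g i j x y.
  by rewrite /fundamental_tensor dY_def.
have ug x y : D (x, y) -> \matrix_(i, j) g i j x y \in unitmx.
  by move=> Dxy; rewrite -gE; exact: fundamental_tensor_unit.
pose v k l : field R n := fun x y => invmx (\matrix_(i, j) g i j x y) k l.
have sv k l : smooth_field D (v k l) by exact: smooth_field_invmx.
have ev k l : euler D 0 (v k l) by exact: euler_invmx.
pose c l k : field R n := fun x y => dY l (dX k (sqf F)) x y * y 0 k.
have sc l k : smooth_field D (c l k).
  apply: smooth_onM; [exact: oD|exact: (smooth_dy oD l (smooth_dx oD k sE))|].
  exact: (smooth_coord oD k).
have ec l k : euler D 2 (c l k).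
  rewrite (_ : 2 = (2 - 1) + 1 :> R); last by ring.
  apply: eulerM => //; last exact: euler_coord.
  - exact: (smooth_dy oD l (smooth_dx oD k sE)).
  - exact: (smooth_coord oD k).
  - exact: (euler_dy oD l (smooth_dx oD k sE) (euler_dx oD k sE eE)).
pose b l : field R n := fun x y => \sum_k c l k x y - dX l (sqf F) x y.
have ssc l : smooth_field D (fun x y => \sum_k c l k x y).
  apply: (@smooth_on_sum _ _ _ oD _ _ _ (fun k (z : V * V) => c l k z.1 z.2)).
  exact: sc.
have sd l : smooth_field D (fun x y => - dX l (sqf F) x y).
  by apply: smooth_onN; [exact: oD|exact: (smooth_dx oD l sE)].
have sb l : smooth_field D (b l).
  by apply: smooth_onD; [exact: oD|exact: ssc|exact: sd].
have eb l : euler D 2 (b l).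
  apply: eulerD => //; first by apply: euler_sum => //.
  apply: eulerN; [exact: oD|exact: (smooth_dx oD l sE)|].
  exact: (euler_dx oD l sE eE).
have GE : geodesic_coef F i = fun x y => 4^-1 * \sum_l (v i l x y * b l x y).
  apply/funext => x; apply/funext => y; rewrite /geodesic_coef dX_def dY_def.
  by rewrite gE.
have svb l : smooth_field D (fun x y => v i l x y * b l x y).
  by apply: smooth_onM; [exact: oD|exact: sv|exact: sb].
have evb l : euler D 2 (fun x y => v i l x y * b l x y).
  by rewrite -(add0r 2); exact: (eulerM oD (sv i l) (sb l) (ev i l) (eb l)).
have ss : smooth_field D (fun x y => \sum_l v i l x y * b l x y).
  apply: (@smooth_on_sum _ _ _ oD _ _ _
    (fun l (z : V * V) => v i l z.1 z.2 * b l z.1 z.2)).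
  exact: svb.
rewrite GE; split.
  by apply: smooth_onM; [exact: oD|exact: smooth_on_cst|exact: ss].
rewrite -(add0r 2); apply: eulerM => //.
- exact: smooth_on_cst.
- exact: euler_cst.
- exact: (euler_sum oD svb evb).
Qed.

End GeodesicSpray.

(** * Assembly chart by chart on the slit tangent bundle *)

Lemma open_slit (R : realType) (n : nat) (M : topologicalType)
  (A : smooth_atlas R n M) (a : chart_index A) : open (slit a).
Proof.
have -> : slit a = (fst @^-1` chart_cod a) `&` (snd @^-1` [set y | y != 0]).
  by [].
apply: openI; apply: open_comp.
- by move=> z _; exact: cvg_fst.
- exact: open_chart_cod.
- by move=> z _; exact: cvg_snd.
have -> : [set y : 'rV[R]_n | y != 0] = ~` [set 0].
  by apply/seteqP; split => y /= /eqP.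
rewrite openC; apply: accessible_closed_set1.
exact/hausdorff_accessible/norm_hausdorff.
Qed.

Theorem theorem2p1 (R : realType) (n : nat) (M : topologicalType)
  (A : smooth_atlas R n M) (hM : smooth_manifold A)
  (F : chart_index A -> field R n) (hF : finsler_metric F)
  (rho : spray_coef A -> chart_index A -> field R n)
  (hrho : generalized_projective rho (geodesic_spray F)) :
  GPR_quadratic F (rho (geodesic_spray F)) <->
  (forall (a : chart_index A) (x y : 'rV[R]_n), slit a (x, y) ->
    forall i j k l : 'I_n,
      let G := geodesic_spray F a in
      let rhoG := rho (geodesic_spray F) a in
      let PB := berwald (projective_spray rhoG G) in
      horizontal_derivative0 G PB i j k l x y
      - \sum_r dy r rhoG x y * PB r j k l x y * y 0 i = 0).
Proof.
have [[_ srho hrho1] _] := hrho.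
have [_ _ sF hF1 convF] := hF.
have oS (a : chart_index A) : open (slit a) by exact: open_slit.
have eF a : euler (slit a) 1 (F a).
  by apply: euler_homogeneous (sF a) _ => // x y t [cx _]; exact: hF1.
have erho a : euler (slit a) 1 (rho (geodesic_spray F) a).
  by apply: euler_homogeneous (srho a) _ => // x y t; exact: hrho1.
have sG a i : smooth_field (slit a) (geodesic_spray F a i).
  by have [] := geodesic_coef_smooth_euler (oS a) (sF a) (eF a) (convF a) i.
have eG a i : euler (slit a) 2 (geodesic_spray F a i).
  by have [] := geodesic_coef_smooth_euler (oS a) (sF a) (eF a) (convF a) i.
(* In each chart [key] equates quadraticity with the vanishing of [|0] taken for the projective
   spray; [PE] then rewrites that derivative in terms of the spray of [F]. *)
have key a := dy_riemann4_eq0 (oS a)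
  (projective_spray_smooth (oS a) (sG a) (srho a))
  (projective_spray_euler (oS a) (sG a) (eG a) (srho a) (erho a)).
have PE a x y (Dxy : slit a (x, y)) i j k l := horizontal_berwald_projective
  (oS a) (sG a) (eG a) (srho a) (erho a) i j k l Dxy.
split=> [Q a x y Dxy i j k l|Q a].
  by rewrite /= PE//; have /key := Q a; apply.
by apply/key => x y Dxy i j k l; rewrite -PE//; exact: Q.
Qed.
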